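(* Let $A\in\mathbb{R}^{n\times n}$, $B\in\mathbb{R}^{n\times m}$, $C\in\mathbb{R}^{p\times n}$ be such that $(A,C)$ is observable, and let $L\in\mathbb{R}^{n\times p}$ be such that $\Lambda(s)=\det(sI-A+LC)$ is stable (all roots have negative real part). Let $M$, $A_\zeta$ be the matrices associated with $(A,B,C,L)$ as defined in the context. Then, for any $Q_y=Q_y^T\in\mathbb{R}^{p\times p}$ with $Q_y>0$, the pair $(A_\zeta,\sqrt{Q_y}\,CM)$ is detectable.
   Context: $\sqrt{Q_y}$ is the unique positive semi-definite square root of $Q_y$. Let $\Lambda(s)=\det(sI-A+LC)=s^n+\alpha_{n-1}s^{n-1}+\cdots+\alpha_1 s+\alpha_0$, and let $D_0,\dots,D_{n-1}\in\mathbb{R}^{n\times n}$ be the constant matrices with $(sI-A+LC)^{-1}=\frac{1}{\Lambda(s)}\sum_{j=0}^{n-1}D_js^j$. For $i=1,\dots,m$ let $f_i$ be the $i$-th column of $B$, and for $i=m+1,\dots,m+p$ let $f_i$ be the $(i-m)$-th column of $L$. Set $M_i=[D_0f_i,\dots,D_{n-1}f_i]\in\mathbb{R}^{n\times n}$ and $M=[M_1,\dots,M_{m+p}]\in\mathbb{R}^{n\times(m+p)n}$. Let $\mathcal{A}\in\mathbb{R}^{n\times n}$ be the companion matrix with ones on the first superdiagonal, last row $(-\alpha_0,-\alpha_1,\dots,-\alpha_{n-1})$ and zeros elsewhere, and $b=(0,\dots,0,1)^T\in\mathbb{R}^n$. With $\otimes$ the Kronecker product and $\mathbf{0}$ a zero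 block of compatible size, $$A_\zeta=(I_{m+p}\otimes\mathcal{A})+\begin{bmatrix}\mathbf{0}\\ I_p\otimes b\end{bmatrix}CM\in\mathbb{R}^{(m+p)n\times(m+p)n}.$$ *)

(* Defs.v *)
From HB Require Import structures.
From mathcomp Require Import all_boot all_order all_algebra.
From mathcomp Require Import reals.
From mathcomp Require Export complex mxtens.

Set Implicit Arguments.
Unset Strict Implicit.
Unset Printing Implicit Defensive.

Import Order.TTheory GRing.Theory Num.Theory.

Local Open Scope ring_scope.

Section LinearSystems.
Variable R : realType.

(* R[i] is the field of complex numbers; the (continuous-time) stability region
   is the open left half-plane. *)
Definition stable_poly (q : {poly R}) : Prop :=
  forall s : R[i], root (map_poly (real_complex R) q) s -> complex.Re s < 0.

Definition hurwitz n (F : 'M[R]_n) : Prop :=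
  forall s : R[i],
    eigenvalue (map_mx (real_complex R) F) s -> complex.Re s < 0.

Definition observability_mx n p (A : 'M[R]_n) (C : 'M[R]_(p, n)) :
    'M[R]_(\sum_(k < n) p, n) :=
  \mxcol_(k < n) (C *m A ^+ k).

Definition observable n p (A : 'M[R]_n) (C : 'M[R]_(p, n)) : Prop :=
  \rank (observability_mx A C) = n.

Definition detectable n p (A : 'M[R]_n) (C : 'M[R]_(p, n)) : Prop :=
  exists K : 'M[R]_(n, p), hurwitz (A - K *m C).

Definition symmetric_mx n (Q : 'M[R]_n) : Prop := Q^T = Q.

Definition posdef_mx n (Q : 'M[R]_n) : Prop :=
  symmetric_mx Q /\
  forall x : 'cV[R]_n, x != 0 -> 0 < (x^T *m Q *m x) 0 0.

Definition possemidef_mx n (Q : 'M[R]_n) : Prop :=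
  symmetric_mx Q /\
  forall x : 'cV[R]_n, 0 <= (x^T *m Q *m x) 0 0.

Definition is_psd_sqrt n (Q S : 'M[R]_n) : Prop :=
  possemidef_mx S /\ S *m S = Q.

(* D lists the coefficients of the numerator of the resolvent of F:
   (s I - F)^-1 = Lambda(s)^-1 * \sum_j D_j s^j, with Lambda the characteristic
   polynomial of F, for every complex s at which the resolvent is defined.
   This determines D, the D_j being the coefficients of \adj (s I - F). *)
Definition resolvent_coefs n (F : 'M[R]_n) (D : 'I_n -> 'M[R]_n) : Prop :=
  forall s : R[i],
    let Lambda_s := (map_poly (real_complex R) (char_poly F)).[s] in
    Lambda_s != 0 ->
    invmx (s%:M - map_mx (real_complex R) F) =
      Lambda_s^-1 *: \sum_(j < n) s ^+ j *: map_mx (real_complex R) (D j).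

(* Ones on the first superdiagonal, last row (- q_0, ..., - q_(n-1)). *)
Definition companion n (q : {poly R}) : 'M[R]_n :=
  \matrix_(i, j) if i.+1 == n then - q`_j else (i.+1 == j :> nat)%:R.

Definition last_basis n : 'cV[R]_n := \col_i (i.+1 == n)%:R.

Section NonMinimalRealization.
Variables (n m p : nat).
Variables (A : 'M[R]_n) (B : 'M[R]_(n, m)) (C : 'M[R]_(p, n)).
Variables (L : 'M[R]_(n, p)) (D : 'I_n -> 'M[R]_n).

Definition input_col (i : 'I_(m + p)) : 'cV[R]_n := col i (row_mx B L).

(* Column j of M_i is D_j f_i. *)
Definition M_block (i : 'I_(m + p)) : 'M[R]_n :=
  \matrix_(r, j) (D j *m input_col i) r 0.

(* M = [M_1, ..., M_(m+p)]: column i * n + j of M is column j of M_i. *)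
Definition M_mx : 'M[R]_(n, (m + p) * n) :=
  \matrix_(r, k) M_block (mxtens_unindex k).1 r (mxtens_unindex k).2.

(* [0; I_p *t b]; the casts only identify (m + p) * n with m * n + p * n
   and p with p * 1. *)
Definition injection_mx : 'M[R]_((m + p) * n, p) :=
  castmx (esym (mulnDl m p n), muln1 p)
    (col_mx (0 : 'M[R]_(m * n, p * 1)) ((1%:M : 'M[R]_p) *t last_basis n)).

Definition A_zeta : 'M[R]_((m + p) * n) :=
  (1%:M : 'M[R]_(m + p)) *t companion n (char_poly (A - L *m C))
  + injection_mx *m (C *m M_mx).

End NonMinimalRealization.
End LinearSystems.

(* Main.v *)
Require Import Defs.
From mathcomp Require Import all_boot all_order all_algebra.
From mathcomp Require Import reals.

Import Order.TTheory GRing.Theory Num.Theory.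
Local Open Scope ring_scope.

(** The matrix [A_zeta] is, by construction, the block-diagonal matrix
    I (x) companion(Lambda) perturbed by the output injection
    [injection_mx *m (C *m M_mx)].  The measured output sqrt(Q_y) C M carries
    the same information as C M, because a square root of a positive definite
    matrix is invertible ([posdef_sqrt_unit]); hence the output injection gain
    [injection_mx *m invmx sqrtQy] cancels the perturbation exactly.  What
    remains is I (x) companion(Lambda), whose eigenvalues are those of the
    companion matrix ([eigenvalue_tens1mx]), i.e. the roots of Lambda
    ([char_poly_companion]), and Lambda is stable. *)

(** An eigenvector of the block-diagonal matrix I (x) F has a nonzero block,
    and each block is mapped by F independently of the others. *)
Lemma eigenvalue_tens1mx (K : fieldType) (k n : nat) (F : 'M[K]_n) (a : K) :
  eigenvalue ((1%:M : 'M[K]_k) *t F) a -> eigenvalue F a.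
Proof.
move=> /eigenvalueP[v vF /rV0Pn[l]].
case: (mxtens_indexP l) => i j vij_neq0.
apply/eigenvalueP; exists (\row_j' v 0 (mxtens_index (i, j'))); last first.
  by apply/rV0Pn; exists j; rewrite mxE.
apply/rowP => c; rewrite !mxE.
have /rowP/(_ (mxtens_index (i, c))) := vF; rewrite !mxE => <-.
rewrite (reindex (@mxtens_index k n)) /=; last first.
  by exists (@mxtens_unindex k n) => x _;
     rewrite (mxtens_indexK, mxtens_unindexK).
pose term i' j' := v 0 (mxtens_index (i', j')) *
  ((1%:M : 'M[K]_k) *t F) (mxtens_index (i', j')) (mxtens_index (i, c)).
rewrite (eq_bigr (fun ij => term ij.1 ij.2)); last by case.
rewrite -(pair_bigA _ term) /term.
rewrite (bigD1 i) //= [X in _ + X]big1 ?addr0 => [|i' /negPf i'_neq_i].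
  by apply: eq_bigr => j' _; rewrite tensmxE !mxE eqxx mul1r.
by apply: big1 => j' _; rewrite tensmxE !mxE i'_neq_i mul0r mulr0.
Qed.

Lemma char_poly_companion (R : realType) (n : nat) (q : {poly R}) :
  q \is monic -> size q = n.+1 -> char_poly (companion n q) = q.
Proof.
move=> q_monic size_q; have n_def : n = (size q).-1 by rewrite size_q.
rewrite -[RHS](companionmxK q_monic); rewrite {size_q}n_def.
congr char_poly; apply/matrixP => i j; rewrite !mxE.
congr (if _ then _ else _).
by rewrite -[RHS]eqSS prednK // (leq_ltn_trans (leq0n i)).
Qed.

Lemma posdef_unit (R : realType) (p : nat) (Q : 'M[R]_p) :
  posdef_mx Q -> Q \in unitmx.
Proof.
case=> _ Q_pos; rewrite unitmxE unitfE; apply/negP => /det0P[v v_neq0 vQ].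
have /Q_pos : v^T != 0 by rewrite trmx_eq0.
by rewrite trmxK vQ mul0mx mxE ltxx.
Qed.

Lemma posdef_sqrt_unit (R : realType) (p : nat) (Q S : 'M[R]_p) :
  posdef_mx Q -> is_psd_sqrt Q S -> S \in unitmx.
Proof.
by move=> /posdef_unit Q_unit [_ SS]; move: Q_unit; rewrite -SS unitmx_mul andbb.
Qed.

Lemma hurwitz_tens_companion (R : realType) (k n : nat) (F : 'M[R]_n) :
  stable_poly (char_poly F) ->
  hurwitz ((1%:M : 'M[R]_k) *t companion n (char_poly F)).
Proof.
move=> stableF s; rewrite map_mxT map_mx1 => /eigenvalue_tens1mx.
rewrite eigenvalue_root_char -map_char_poly char_poly_companion.
- exact: stableF.
- exact: char_poly_monic.
- exact: size_char_poly.
Qed.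

Theorem lemma7 (R : realType) (n m p : nat)
    (A : 'M[R]_n) (B : 'M[R]_(n, m)) (C : 'M[R]_(p, n)) (L : 'M[R]_(n, p))
    (D : 'I_n -> 'M[R]_n) (Qy sqrtQy : 'M[R]_p) :
  observable A C ->
  stable_poly (char_poly (A - L *m C)) ->
  resolvent_coefs (A - L *m C) D ->
  posdef_mx Qy ->
  is_psd_sqrt Qy sqrtQy ->
  detectable (A_zeta A B C L D) (sqrtQy *m (C *m M_mx B L D)).
Proof.
move=> _ stableALC _ Qy_pos sqrtQyP.
have S_unit := posdef_sqrt_unit _ _ _ _ Qy_pos sqrtQyP.
exists (@injection_mx R n m p *m invmx sqrtQy).
rewrite -mulmxA (mulKmx S_unit) /A_zeta addrK.
exact: hurwitz_tens_companion.
Qed.
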